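(* Let $\beta>2$ be an irrational real number and let $\alpha=\beta/(\beta-1)$. Then the set of $P$-positions of the game $\beta$-Wythoff Nim is exactly $$\{(\lfloor n\alpha\rfloor,\lfloor n\beta\rfloor),\ (\lfloor n\beta\rfloor,\lfloor n\alpha\rfloor)\mid n\in\mathbb{Z}_{\ge 0}\}.$$
   Context: For an irrational $\beta>2$, the game $\beta$-Wythoff Nim is the following two-player impartial take-away game. Put $k=\lfloor\beta\rfloor$. Positions are the pairs $(x,y)$ of non-negative integers. There are two types of moves: (Nim type) $(x,y)\to(x-t,y)$ with $t$ a positive integer and $x-t\ge 0$, or $(x,y)\to(x,y-t)$ with $t$ a positive integer and $y-t\ge 0$. (Extended diagonal type) $(x,y)\to(x-s,y-t)$ with $s,t$ positive integers, $|s-t|<k$, $x-s\ge 0$ and $y-t\ge 0$. Rules: if neither $x$ nor $y$ is of the form $\lfloor\beta n\rfloor$ with $n\in\mathbb{Z}_{>0}$, then all Nim type and all extended diagonal type moves are allowed from $(x,y)$. If at least one of $x,y$ is of the form $\lfloor\beta n\rfloor$ with $n\in\mathbb{Z}_{>0}$, then only Nim type moves are allowed from $(x,y)$. The two players alternate moves under normal play: the player making the last move wins (a player unable to move loses). A position is a $P$-position if the previous player (the one not about to move) has a winning strategy, and an $N$-position otherwise. Equivalently, the $P$-positions are defined recursively: a position is a $P$-position if and only if none of the positions reachable from it in one legal move is a $P$-position. *)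

(* Defs.v *)
From HB Require Import structures.
From mathcomp Require Import all_boot all_order all_algebra.
From mathcomp Require Import all_classical all_reals.

Set Implicit Arguments.
Unset Strict Implicit.
Unset Printing Implicit Defensive.

Import Order.TTheory GRing.Theory Num.Theory.
Local Open Scope ring_scope.

(* Outcomes of an impartial game under normal play; [move p q] means that [q]
   is an option of [p].  Being inductive, [P_pos] and [N_pos] describe wins
   that are forced in finitely many moves. *)
Inductive P_pos (T : Type) (move : T -> T -> Prop) (p : T) : Prop :=
  | PPos of forall q, move p q -> N_pos move q
with N_pos (T : Type) (move : T -> T -> Prop) (p : T) : Prop :=
  | NPos q of move p q & P_pos move q.

(* [Num.truncn x] is the floor of [x] as a natural number when [0 <= x], and
   [0] when [x < 0]; below it is applied to nonnegative reals only, as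
   [2 < beta]. *)
Definition in_beatty (R : realType) (beta : R) (x : nat) : Prop :=
  exists2 n : nat, (0 < n)%N & x = Num.truncn (n%:R * beta).

(* In [diag_move], [`|s - t|%N] is the absolute value of the integer
   difference, not of the truncated one. *)
Inductive wythoff_move (R : realType) (beta : R) :
    nat * nat -> nat * nat -> Prop :=
  | nim_move_l (x y t : nat) of (0 < t)%N & (t <= x)%N :
      wythoff_move beta (x, y) ((x - t)%N, y)
  | nim_move_r (x y t : nat) of (0 < t)%N & (t <= y)%N :
      wythoff_move beta (x, y) (x, (y - t)%N)
  | diag_move (x y s t : nat) of
      ~ in_beatty beta x & ~ in_beatty beta y &
      (0 < s)%N & (s <= x)%N & (0 < t)%N & (t <= y)%N &
      (`|s - t| < Num.truncn beta)%N :
      wythoff_move beta (x, y) ((x - s)%N, (y - t)%N).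

Definition wythoff_P_positions (R : realType) (beta : R) : set (nat * nat) :=
  [set p | P_pos (wythoff_move beta) p]%classic.

Lemma wythoff_move_decr (R : realType) (beta : R) (p q : nat * nat) :
  wythoff_move beta p q -> (q.1 + q.2 < p.1 + p.2)%N.
Proof.
case=> /= [x y t t0 tx|x y t t0 ty|x y s t _ _ s0 sx t0 ty _].
- by rewrite ltn_add2r ltn_subrL t0 (leq_trans t0).
- by rewrite ltn_add2l ltn_subrL t0 (leq_trans t0).
- by rewrite -addSn leq_add// ?leq_subr// ltn_subrL s0 (leq_trans s0).
Qed.

Lemma wythoff_N_posE (R : realType) (beta : R) (p : nat * nat) :
  N_pos (wythoff_move beta) p <-> ~ P_pos (wythoff_move beta) p.
Proof.
have [n] := ubnP (p.1 + p.2)%N; elim: n p => // n IHn p /ltnSE lepn.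
have IH q : wythoff_move beta p q ->
    (N_pos (wythoff_move beta) q <-> ~ P_pos (wythoff_move beta) q).
  by move=> pq; apply: IHn; apply: leq_trans (wythoff_move_decr pq) lepn.
split=> [[q pq Pq] [/(_ q pq)/(IH q pq)]//|nPp].
apply: contrapT => nNp; apply: nPp; constructor=> q pq.
by apply/(IH q pq) => Pq; apply: nNp; exists q.
Qed.

Lemma wythoff_P_posE (R : realType) (beta : R) (p : nat * nat) :
  P_pos (wythoff_move beta) p <->
  forall q, wythoff_move beta p q -> ~ P_pos (wythoff_move beta) q.
Proof.
by split=> [[Np] q /Np/wythoff_N_posE|nP]//; constructor=> q /nP/wythoff_N_posE.
Qed.

(* Main.v *)
Require Import Defs.
From mathcomp Require Import all_boot all_order all_algebra.
From mathcomp Require Import all_classical all_reals.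
From mathcomp Require Import zify ring lra.

Import Order.TTheory GRing.Theory Num.Theory.
Local Open Scope classical_set_scope.
Local Open Scope ring_scope.

(** Since [alpha^-1 + beta^-1 = 1], the positive terms of the two sequences
    [floor (n alpha)] and [floor (n beta)] partition the positive integers
    (Beatty's theorem, [beatty_disjoint] and [beatty_cover]).  The set [S] of
    the pairs [(floor (n alpha), floor (n beta))] and of their mirror images is
    then a kernel of the game, that is, the set of P-positions
    ([wythoff_kernel]).

    No move joins two positions of [S] ([beatty_pairs_stable]): by
    complementarity each coordinate of a position in [S] determines the other,
    which excludes Nim moves, and each position of [S] except [(0, 0)] has a
    coordinate of the form [floor (n beta)] with [0 < n], which blocks the
    diagonal moves.

    Every position outside [S] can move into [S] ([beatty_pairs_absorbing]).
    If a coordinate is [floor (n beta)], or if the larger coordinate exceeds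
    the partner of the smaller one, a Nim move is enough.  The remaining case
    is [(floor (m alpha), y)] with [floor (m alpha) <= y < floor (m beta)], no
    coordinate being a term of the [beta] sequence ([diagonal_descent]).  The
    differences [floor (j beta) - floor (j alpha)] start at [0] and grow by at
    most [floor beta] at each step, so one of them, with [j < m], falls short
    of [y - floor (m alpha)] by less than [floor beta]; the diagonal move to
    the [j]-th pair is thus legal. *)

(** * Beatty sequences *)

Definition beatty {R : realType} (r : R) (n : nat) : nat :=
  Num.truncn (n%:R * r).

Lemma beatty_itv {R : realType} (r : R) (n : nat) : 0 <= r ->
  (beatty r n)%:R <= n%:R * r < (beatty r n).+1%:R.
Proof. by move=> r0; apply: truncn_itv; rewrite mulr_ge0. Qed.

Lemma beattyE {R : realType} (r : R) (n N : nat) :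
  N%:R <= n%:R * r < N.+1%:R -> beatty r n = N.
Proof. exact: truncn_def. Qed.

Lemma beatty0 {R : realType} (r : R) : beatty r 0 = 0%N.
Proof. by apply: beattyE; rewrite mul0r lexx ltr01. Qed.

Lemma beatty_mono {R : realType} (r : R) : 1 <= r ->
  {mono beatty r : m n / (m <= n)%N}.
Proof.
move=> r1; apply: leq_mono; apply: homo_ltn => [m n p|n]; first exact: ltn_trans.
have r0 : 0 <= r by lra.
have /andP[lo _] := beatty_itv r n r0; have /andP[_ hi] := beatty_itv r n.+1 r0.
rewrite -ltnS -(ltr_nat R) -natr1; apply: le_lt_trans hi.
by rewrite -natr1 mulrDl mul1r lerD.
Qed.

Lemma beatty_step {R : realType} (r : R) (n : nat) : 0 <= r ->
  (beatty r n.+1 <= (beatty r n + Num.truncn r).+1)%N.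
Proof.
move=> r0; have /andP[_ hi] := beatty_itv r n r0.
have /andP[lo _] := beatty_itv r n.+1 r0.
have := truncnS_gt r; rewrite -ltnS -(ltr_nat R) => rk.
by move: lo hi rk; rewrite -!natr1 natrD; lra.
Qed.

Lemma irrational_neq_nat {R : realType} (r : R) (n N : nat) :
  irrational r -> (0 < n)%N -> n%:R * r != N%:R.
Proof.
move=> irr n0; apply/eqP => eN; apply: irr; exists (N%:R / n%:R) => //.
by rewrite fmorph_div !rmorph_nat -eN mulrAC divff ?mul1r// pnatr_eq0 -lt0n.
Qed.

(** A common value [N] would give [N / r <= m < (N + 1) / r] and, strictly since
    [s] is irrational, [N / s < n < (N + 1) / s].  Adding these, [m + n] would
    be an integer strictly between [N] and [N + 1]. *)
Lemma beatty_disjoint {R : realType} (r s : R) (m n : nat) :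
  0 < r -> 0 < s -> r^-1 + s^-1 = 1 -> irrational s -> (0 < n)%N ->
  beatty r m <> beatty s n.
Proof.
move=> r0 s0 rs irr n0 e.
have /andP[] := beatty_itv r m (ltW r0); rewrite e; set N := beatty s n.
have /andP[] := beatty_itv s n (ltW s0); rewrite -/N.
rewrite le_eqVlt eq_sym (negPf (irrational_neq_nat s n N irr n0)) /=.
rewrite -(ltr_pdivrMr _ N%:R) // -(ltr_pdivlMr n%:R) //.
rewrite -(ler_pdivrMr _ N%:R) // -(ltr_pdivlMr m%:R) //.
have -> : s^-1 = 1 - r^-1 by lra.
move=> h1 h2 h3 h4.
have : N%:R < (m + n)%:R :> R by rewrite natrD; lra.
have : (m + n)%:R < N.+1%:R :> R by move: h2 h4; rewrite natrD -!natr1; lra.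
by rewrite !ltr_nat ltnS leqNgt => /negP.
Qed.

(** With [m] and [n] the integer parts of [N / r] and [N / s], the candidate
    preimages of [N] are [m], [m + 1] and [n + 1].  If the last two fail, then
    [(N + 1) / r <= m + 1] and [(N + 1) / s < n + 1], so [N <= m + n]; as
    [m <= N / r] and [n <= N / s], this forces [m = N / r], and [m] is a
    preimage. *)
Lemma beatty_cover {R : realType} (r s : R) (N : nat) :
  0 < r -> 0 < s -> r^-1 + s^-1 = 1 -> irrational s ->
  exists n, N = beatty r n \/ N = beatty s n.
Proof.
move=> r0 s0 rs irr.
have N0 (t : R) : 0 < t -> 0 <= N%:R / t by move=> t0; rewrite divr_ge0// ltW.
have hit (t : R) j : 0 < t -> N%:R / t <= j%:R -> j%:R < N.+1%:R / t ->
    N = beatty t j.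
  move=> t0 h1 h2; apply/esym/beattyE.
  by rewrite -(ler_pdivrMr _ N%:R) // -(ltr_pdivlMr j%:R) // h1.
have /andP[] := truncn_itv (N0 r r0); set m := Num.truncn _ => mN Nm.
have /andP[] := truncn_itv (N0 s s0); set n := Num.truncn _ => nN Nn.
have [h|Nm'] := ltP m.+1%:R (N.+1%:R / r).
  by exists m.+1; left; apply: hit; rewrite // ltW.
have [h|] := ltP n.+1%:R (N.+1%:R / s).
  by exists n.+1; right; apply: hit; rewrite // ltW.
rewrite ler_pdivrMr// le_eqVlt eq_sym.
rewrite (negPf (irrational_neq_nat s n.+1 N.+1 irr (ltn0Sn n))) /=.
rewrite -(ltr_pdivrMr _ N.+1%:R)// => Nn'.
have es : s^-1 = 1 - r^-1 by lra.
exists m; left; apply: hit => //; last first.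
  by apply: le_lt_trans mN _; rewrite ltr_pM2r ?invr_gt0// ltr_nat.
have : N.+1%:R < (m + n).+2%:R :> R.
  move: Nn' Nm'; rewrite es -!natr1 natrD; lra.
rewrite ltr_nat !ltnS -(ler_nat R) natrD => Nmn.
move: nN Nmn; rewrite es; lra.
Qed.

(** * The game *)

(** A set of positions that no move joins internally, and that every position
    outside it can enter, is the set of P-positions: by induction on the
    decreasing sum of the heaps, the next player loses on it and wins off it,
    and no position is both a P- and an N-position. *)
Lemma wythoff_kernel {R : realType} (beta : R) (S : set (nat * nat)) :
  (forall p q, S p -> wythoff_move beta p q -> ~ S q) ->
  (forall p, ~ S p -> exists2 q, wythoff_move beta p q & S q) ->
  wythoff_P_positions beta = S.
Proof.
move=> stable absorbing.
have PN p : (S p -> P_pos (wythoff_move beta) p) /\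
            (~ S p -> N_pos (wythoff_move beta) p).
  have [n] := ubnP (p.1 + p.2)%N; elim: n p => // n IHn p /ltnSE lepn.
  have IH q (pq : wythoff_move beta p q) := IHn q (leq_trans (wythoff_move_decr pq) lepn).
  split=> [Sp|/absorbing[q pq Sq]].
    by constructor=> q pq; apply: (IH q pq).2; apply: stable pq.
  by exists q => //; apply: (IH q pq).1.
apply/seteqP; split=> p; last exact: (PN p).1.
by move=> Pp; apply: contrapT => /(PN p).2 /wythoff_N_posE; apply.
Qed.

Lemma wythoff_move_swap {R : realType} (beta : R) (p q : nat * nat) :
  wythoff_move beta p q -> wythoff_move beta (p.2, p.1) (q.2, q.1).
Proof.
case=> [x y t t0 tx|x y t t0 ty|x y s t nx ny s0 sx t0 ty st] /=.
- exact: nim_move_r.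
- exact: nim_move_l.
- by apply: diag_move => //; rewrite distnC.
Qed.

Definition beatty_pairs {R : realType} (alpha beta : R) : set (nat * nat) :=
  [set p | exists n : nat,
     p = (beatty alpha n, beatty beta n) \/ p = (beatty beta n, beatty alpha n)].

Lemma beatty_pairs_swap {R : realType} (alpha beta : R) (x y : nat) :
  beatty_pairs alpha beta (x, y) -> beatty_pairs alpha beta (y, x).
Proof. by case=> n [[-> ->]|[-> ->]]; exists n; [right|left]. Qed.

(** The crossed case, where [x] occurs in both sequences, is confined to
    [x = 0] by complementarity, and the partner of [0] is [0]. *)
Lemma beatty_pairs_row {R : realType} (alpha beta : R) (x y y' : nat) :
  1 < alpha -> 1 < beta -> alpha^-1 + beta^-1 = 1 -> irrational beta ->
  beatty_pairs alpha beta (x, y) -> beatty_pairs alpha beta (x, y') -> y = y'.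
Proof.
move=> a1 b1 ab irr.
have inj (r : R) : 1 < r -> injective (beatty r).
  by move=> r1; apply: incn_inj; apply: beatty_mono; apply: ltW.
have disj m n : beatty alpha m = beatty beta n -> m = 0%N /\ n = 0%N.
  move=> e; have [n0|n0] := posnP n; last first.
    by case: (beatty_disjoint alpha beta m n _ _ ab irr n0 e); lra.
  by split=> //; apply: (inj _ a1); rewrite e n0 !beatty0.
move=> [m [[-> ->]|[-> ->]]] [n [[e ->]|[e ->]]].
- by rewrite (inj _ a1 _ _ e).
- by have [-> ->] := disj _ _ e; rewrite !beatty0.
- by have [-> ->] := disj _ _ (esym e); rewrite !beatty0.
- by rewrite (inj _ b1 _ _ e).
Qed.

Lemma beatty_pairs_stable {R : realType} (alpha beta : R) (p q : nat * nat) :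
  1 < alpha -> 1 < beta -> alpha^-1 + beta^-1 = 1 -> irrational beta ->
  beatty_pairs alpha beta p -> wythoff_move beta p q ->
  ~ beatty_pairs alpha beta q.
Proof.
move=> a1 b1 ab irr Sp pq; have row := beatty_pairs_row alpha beta.
case: pq Sp => [x y t t0 tx|x y t t0 ty|x y s t nx ny s0 sx t0 ty _].
- move=> /beatty_pairs_swap Sp /beatty_pairs_swap Sq.
  by have := row _ _ _ a1 b1 ab irr Sp Sq; lia.
- by move=> Sp Sq; have := row _ _ _ a1 b1 ab irr Sp Sq; lia.
- have n0 n : ~ in_beatty beta (beatty beta n) -> n = 0%N.
    by case: n => // n []; exists n.+1.
  case=> n [[ex ey]|[ex ey]] _.
  + have en : n = 0%N by apply: n0; rewrite -ey.
    by move: sx s0; rewrite ex en beatty0; lia.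
  + have en : n = 0%N by apply: n0; rewrite -ex.
    by move: sx s0; rewrite ex en beatty0; lia.
Qed.

Lemma nim_descent_row {R : realType} (alpha beta : R) (x y y' : nat) :
  (y' < y)%N -> beatty_pairs alpha beta (x, y') ->
  exists2 q, wythoff_move beta (x, y) q & beatty_pairs alpha beta q.
Proof.
move=> lt S; exists (x, y') => //.
have -> : y' = (y - (y - y'))%N by lia.
by apply: nim_move_r; lia.
Qed.

Lemma absorbing_swap {R : realType} (alpha beta : R) (x y : nat) :
  (exists2 q, wythoff_move beta (x, y) q & beatty_pairs alpha beta q) ->
  exists2 q, wythoff_move beta (y, x) q & beatty_pairs alpha beta q.
Proof.
case=> -[u v] /wythoff_move_swap /= m /beatty_pairs_swap S.
by exists (v, u).
Qed.

(** A coordinate [y] above the partner of [x = floor (n beta)] is lowered to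
    it.  If [y] is below, then [y] belongs to a pair with a smaller index, or
    [y] is a term [floor (m beta)] with [floor (m alpha) <= y < x]; in both
    cases [x] is lowered to the partner of [y]. *)
Lemma absorbing_beatty {R : realType} (alpha beta : R) (n y : nat) :
  1 < alpha <= beta -> alpha^-1 + beta^-1 = 1 -> irrational beta ->
  ~ beatty_pairs alpha beta (beatty beta n, y) ->
  exists2 q, wythoff_move beta (beatty beta n, y) q & beatty_pairs alpha beta q.
Proof.
move=> /andP[a1 ab] abE irr nS.
have [ya|ya|ya] := ltngtP y (beatty alpha n).
- apply: absorbing_swap.
  have leab m : (beatty alpha m <= beatty beta m)%N.
    by apply: le_truncn; rewrite ler_wpM2l.
  have amono : {mono beatty alpha : m n / (m <= n)%N}.
    by apply: beatty_mono; lra.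
  have bmono : {mono beatty beta : m n / (m <= n)%N}.
    by apply: beatty_mono; lra.
  have [||m [ey|ey]] := beatty_cover alpha beta y _ _ abE irr; [lra|lra| |].
  + apply: (nim_descent_row _ _ _ _ (beatty beta m)); last first.
      by exists m; left; rewrite ey.
    by rewrite (leqW_mono bmono) -(leqW_mono amono) -ey.
  + apply: (nim_descent_row _ _ _ _ (beatty alpha m)); last first.
      by exists m; right; rewrite ey.
    by have := leab m; have := leab n; lia.
- by apply: (nim_descent_row _ _ _ _ (beatty alpha n)) => //; exists n; right.
- by case: nS; exists n; right; rewrite ya.
Qed.

(** A discrete intermediate value principle. *)
Lemma crossing (d : nat -> nat) (m c : nat) :
  (d 0 <= c < d m)%N -> exists2 j, (j < m)%N & (d j <= c < d j.+1)%N.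
Proof.
case/andP; elim: m => [|m IHm] d0 dm; first by lia.
have [dm'|dm'] := leqP (d m) c; first by exists m; rewrite ?dm'.
by have [j jm dj] := IHm d0 dm'; exists j => //; apply: leqW.
Qed.

(** Write [d j] for [floor (j beta) - floor (j alpha)].  Between the diagonals
    [d j] and [d j.+1] that surround [y - floor (m alpha)] the gap is at most
    [floor beta]: one step adds at most [floor beta + 1] to the larger
    coordinate and at least [1] to the smaller one.  The target lies strictly
    below in the second coordinate as well, since
    [floor (j beta) = floor (j alpha) + d j] with [floor (j alpha)] strictly
    smaller than [floor (m alpha)] and [d j] at most the actual difference. *)
Lemma diagonal_descent {R : realType} (alpha beta : R) (m y : nat) :
  1 < alpha <= beta ->
  ~ in_beatty beta (beatty alpha m) -> ~ in_beatty beta y ->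
  (beatty alpha m <= y < beatty beta m)%N ->
  exists2 q, wythoff_move beta (beatty alpha m, y) q & beatty_pairs alpha beta q.
Proof.
move=> /andP[a1 ab] nx ny /andP[xy yb].
have leab n : (beatty alpha n <= beatty beta n)%N.
  by apply: le_truncn; rewrite ler_wpM2l.
have alt : {mono beatty alpha : m n / (m < n)%N}.
  by apply/leqW_mono/beatty_mono; lra.
have [|j jm /andP[dj djS]] := crossing
    (fun n => beatty beta n - beatty alpha n)%N m (y - beatty alpha m)%N.
  by rewrite !beatty0; lia.
have : (beatty alpha j < beatty alpha j.+1)%N by rewrite alt.
have : (beatty alpha j < beatty alpha m)%N by rewrite alt.
have : (beatty beta j.+1 <= (beatty beta j + Num.truncn beta).+1)%N.
  by apply: beatty_step; lra.
have := leab j; have := leab j.+1; move=> l1 l2 h1 h2 h3.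
exists (beatty alpha j, beatty beta j); last by exists j; left.
have -> : (beatty alpha j, beatty beta j) =
  (beatty alpha m - (beatty alpha m - beatty alpha j), y - (y - beatty beta j))%N.
  by congr pair; lia.
by apply: diag_move => //; lia.
Qed.

Lemma beatty_pairs_absorbing {R : realType} (alpha beta : R) (p : nat * nat) :
  1 < alpha <= beta -> alpha^-1 + beta^-1 = 1 -> irrational beta ->
  ~ beatty_pairs alpha beta p ->
  exists2 q, wythoff_move beta p q & beatty_pairs alpha beta q.
Proof.
case: p => x y a1b ab irr.
wlog xy : x y / (x <= y)%N => [hwlog nS|nS].
  case/orP: (leq_total x y) => [|yx]; first by move/hwlog; apply.
  by apply: absorbing_swap; apply: hwlog => // /beatty_pairs_swap.
have [[n _ ex]|nx] := pselect (in_beatty beta x).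
  rewrite ex; apply: absorbing_beatty => //.
  by rewrite -[beatty _ _]ex.
have [[n _ ey]|ny] := pselect (in_beatty beta y).
  apply: absorbing_swap; rewrite ey; apply: absorbing_beatty => //.
  by rewrite -[beatty _ _]ey => /beatty_pairs_swap.
have [m ex] : exists m, x = beatty alpha m.
  have [||m [|ex]] := beatty_cover alpha beta x _ _ ab irr; [lra|lra|by exists m|].
  exists 0%N; case: m ex => [->|m ex]; first by rewrite !beatty0.
  by case: nx; exists m.+1.
have [yb|yb|yb] := ltngtP y (beatty beta m).
- by move: xy nx; rewrite ex => xy nx; apply: diagonal_descent; rewrite // xy.
- by apply: (nim_descent_row _ _ _ _ (beatty beta m)) => //; exists m; left; rewrite ex.
- by case: nS; exists m; left; rewrite ex yb.
Qed.

Theorem mainTheorem1 (R : realType) (beta alpha : R)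
    (beta_gt2 : 2 < beta) (beta_irr : irrational beta)
    (alphaE : alpha = beta / (beta - 1)) :
  wythoff_P_positions beta =
  [set p | exists n : nat,
     p = (Num.truncn (n%:R * alpha), Num.truncn (n%:R * beta)) \/
     p = (Num.truncn (n%:R * beta), Num.truncn (n%:R * alpha))].
Proof.
have ab : alpha^-1 + beta^-1 = 1.
  by rewrite alphaE invf_div; field; lra.
have a1 : 1 < alpha by rewrite alphaE ltr_pdivlMr; lra.
have alb : alpha <= beta by rewrite alphaE ler_pdivrMr; nra.
apply: (wythoff_kernel _ (beatty_pairs alpha beta)).
- by move=> p q; apply: beatty_pairs_stable => //; lra.
- by move=> p; apply: beatty_pairs_absorbing => //; rewrite a1.
Qed.
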